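(* Let $L_1 \in \mathbb{S}\mathbb{R}^{d\times d}[x]$ be a diagonal linear polynomial such that the set $D_{L_1}(1)=\{x\in\mathbb{R}^n \mid L_1(x)\succeq 0\}$ is bounded. Then for every linear polynomial $L_2\in \mathbb{S}\mathbb{R}^{\ell\times \ell}[x]$ with $L_2|_{D_{L_1}(1)} \succ 0$ (that is, $L_2(x)$ is positive definite for every $x\in D_{L_1}(1)$), there are finitely many matrix polynomials $A_j\in \mathbb{R}^{\ell\times \ell}[x]$ and $B_k\in \mathbb{R}^{d\times \ell}[x]$ satisfying $$L_2=\sum_j A_j^{\ast}A_j+\sum_k B_k^{\ast}L_1 B_k.$$
   Context: Let $x=(x_1,\ldots,x_n)$ be commuting real variables. $\mathbb{R}^{p\times q}[x]$ denotes the set of all polynomials in $x$ whose coefficients are real $p\times q$ matrices, and $\mathbb{S}\mathbb{R}^{d\times d}[x]$ denotes the set of those whose coefficients are symmetric real $d\times d$ matrices. A linear polynomial in $\mathbb{S}\mathbb{R}^{d\times d}[x]$ is one of the form $L(x)=P_0+\sum_{i=1}^n P_i x_i$ with $P_0,\ldots,P_n$ real symmetric $d\times d$ matrices (so constants are allowed). $L$ is diagonal if all its coefficients $P_i$ are diagonal matrices. $M^\ast$ is the transpose of a matrix polynomial $M$. $\succeq 0$ means positive semidefinite, $\succ 0$ means positive definite. *)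

(* Defs.v *)
From HB Require Import structures.
From mathcomp Require Import all_boot all_order all_algebra.
From mathcomp Require Import classical_sets reals topology normedtype.
(* The notations of mpoly clash with those of MathComp-Analysis. *)
From mathcomp Require Import -(notations) mpoly.

Set Implicit Arguments.
Unset Strict Implicit.
Unset Printing Implicit Defensive.

Import Order.TTheory GRing.Theory Num.Theory.
Import numFieldNormedType.Exports.

Local Open Scope classical_set_scope.
Local Open Scope ring_scope.

(* R^{p x q}[x], x = (x_1, ..., x_n), encoded as p x q matrices with entries in
   R[x]; the coefficient matrix at a monomial is recovered by mxcoeff below. *)
Notation mxpoly R n p q := 'M[mpoly n R]_(p, q) (only parsing).

Section MatrixPolynomials.
Variables (R : realType) (n : nat).

Definition mxpolyC p q (A : 'M[R]_(p, q)) : mxpoly R n p q :=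
  map_mx (@mpolyC n R) A.

Definition mxpolyX (i : 'I_n) : mpoly n R := mpolyX R (mnm1 i).

Definition mxcoeff p q (m : multinom n) (L : mxpoly R n p q) :
    'M[R]_(p, q) :=
  map_mx (mcoeff m) L.

Definition mxeval p q (x : 'rV[R]_n) (L : mxpoly R n p q) : 'M[R]_(p, q) :=
  map_mx (meval (fun i => x 0 i)) L.

Definition symmetric_mxpoly d (L : mxpoly R n d d) : Prop :=
  forall m, mxcoeff m L \is symmetricmx.

Definition diagonal_mxpoly d (L : mxpoly R n d d) : Prop :=
  forall m, is_diag_mx (mxcoeff m L).

(* "Linear" includes a constant term. *)
Definition linear_mxpoly d (L : mxpoly R n d d) : Prop :=
  exists (P0 : 'M[R]_d) (P : 'I_n -> 'M[R]_d),
    L = mxpolyC P0 + \sum_i mxpolyX i *: mxpolyC (P i).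

Definition psdmx d (A : 'M[R]_d) : Prop :=
  A \is symmetricmx /\ forall v : 'cV[R]_d, 0 <= (v^T *m A *m v) 0 0.

Definition pdmx d (A : 'M[R]_d) : Prop :=
  A \is symmetricmx /\
  forall v : 'cV[R]_d, v != 0 -> 0 < (v^T *m A *m v) 0 0.

(* D_L(1) = {x in R^n | L(x) >= 0} *)
Definition psd_set d (L : mxpoly R n d d) : set 'rV[R]_n :=
  [set x | psdmx (mxeval x L)].

End MatrixPolynomials.

Arguments mxpolyC {R n p q} A.
Arguments mxpolyX {R n} i.

(* Main.v *)
Require Import Defs.
From HB Require Import structures.
From mathcomp Require Import all_boot all_order all_algebra.
From mathcomp Require Import classical_sets reals topology normedtype.
From mathcomp Require Import boolp derive sequences ring lra.
From mathcomp Require Import -(notations) mpoly.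

(** Write L1 = diag (g_1, ..., g_d), so that the set D on which L1 is positive
    semidefinite is the polytope of all x with every g_i (x) >= 0. Let M be the
    set of the matrix polynomials of the required form ([in_module]) and T the
    quadratic module of the scalar polynomials p such that p v^T v is in M for
    every row v ([scalar_module]); T contains every g_i.

    If D is empty, Farkas' lemma shows that -1 is in T, and then M contains every
    symmetric matrix polynomial ([in_module_symmetric]).

    If D is not empty, Farkas' lemma and the boundedness of D give nonnegative
    multiples y_0, ..., y_d of 1, g_1, ..., g_d that sum to 1 and determine x
    ([polytope_weights]). Thus y identifies D with the intersection of the
    standard simplex with a linear subspace v h = 0, and L2 = \sum_i y_i A_i for
    constant symmetric A_i, where the pencil A (v) = \sum_i v_i A_i is positive
    definite on that slice of the simplex.

    By compactness, A (v) + (C |v h|^2 - e) 1 is positive definite on the whole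
    simplex for suitable C and e > 0 ([pencil_penalty]). Its Bernstein expansion
    of degree N has its samples as coefficients, so it lies in the cone generated
    by the products of the y_i with positive definite coefficients
    ([bernstein_poscone]). The expansion reproduces linear functions, and as
    y h = 0 the penalty contributes to it only a variance of order 1 / N.

    The products of the y_i need not lie in T. However each y_i, having both y_i
    and 1 - y_i in T, is arbitrarily close to a square ([near_square_unit]), where
    distances are taken in the order seminorm of T. This seminorm is
    submultiplicative, so that the products are close to squares as well, and a
    small positive constant pushes the cone into M ([poscone_in_module]). The
    constant e pays for this constant and for the variance
    ([simplex_slice_in_module]). *)

Set Implicit Arguments.
Unset Strict Implicit.
Unset Printing Implicit Defensive.

Import Order.TTheory GRing.Theory Num.Theory.
Import numFieldNormedType.Exports.

Local Open Scope classical_set_scope.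
Local Open Scope ring_scope.

(** * Farkas' lemma *)

(** Induction on the number of rows, after Bartl: if dropping the first row [a]
    breaks the implication at some [w], then [a *m w < 0], and projecting
    everything along [w] onto the hyperplane [a = 0] removes [a] from the
    system. *)
Lemma farkas (F : realFieldType) n m (A : 'M[F]_(m, n)) (b : 'rV[F]_n) :
    (forall z : 'cV[F]_n, (forall i, 0 <= (A *m z) i 0) -> 0 <= (b *m z) 0 0) ->
  exists2 c : 'rV[F]_m, forall i, 0 <= c 0 i & b = c *m A.
Proof.
elim: m A b => [|m IHm]; last rewrite -[m.+1]/(1 + m)%N; move=> A b Ab.
  (* Testing b on plus and minus the unit vectors. *)
  exists 0 => [[]//|]; apply/rowP => j; rewrite mul0mx mxE.
  have e : (b *m (delta_mx j 0 : 'cV_n)) 0 0 = b 0 j.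
    by rewrite -colE !mxE.
  have := Ab (delta_mx j 0) (fun i => match i with Ordinal _ h => match notF h with end end).
  have := Ab (- delta_mx j 0) (fun i => match i with Ordinal _ h => match notF h with end end).
  by rewrite mulmxN mxE e; lra.
move: Ab; rewrite -[A]vsubmxK.
move: (usubmx _) (dsubmx _) => a {}A Ab.
have [/IHm[c c0 bc]|] := pselect (forall z : 'cV[F]_n,
    (forall i, 0 <= (A *m z) i 0) -> 0 <= (b *m z) 0 0).
  exists (row_mx (0 : 'rV_1) c) => [i|]; last by rewrite mul_row_col mul0mx add0r.
  by rewrite mxE; case: split => // k; rewrite mxE.
move=> /existsNP[w /not_implyP[Aw /negP]]; rewrite -ltNge => bw.
have aw : (a *m w) 0 0 < 0.
  rewrite ltNge; apply/negP => aw; move: bw; rewrite ltNge Ab // => i.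
  by rewrite mul_col_mx mxE; case: split => // k; rewrite ord1.
pose t := - ((a *m w) 0 0)^-1; have t0 : 0 < t by rewrite oppr_gt0 invr_lt0.
pose z0 := t *: w.
have az0 : a *m z0 = - 1%:M.
  rewrite /z0 -scalemxAr [a *m w]mx11_scalar scale_scalar_mx /t mulNr.
  by rewrite mulVf ?lt_eqF// -scalemx1 scaleN1r.
have Az0 i : 0 <= (A *m z0) i 0 by rewrite /z0 -scalemxAr mxE mulr_ge0 // ltW.
have bz0 : (b *m z0) 0 0 <= 0 by rewrite /z0 -scalemxAr mxE nmulr_lle0 ?ltW.
(* z0 is w scaled to [a *m z0 = -1], so that z |-> z + z0 *m (a *m z) is the
   projection onto the kernel of a along z0. *)
have [z Az|c c0 bc] := IHm (A + A *m z0 *m a) (b + b *m z0 *m a).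
  have ez p (C : 'M_(p, n)) : C *m (z + z0 *m (a *m z)) = (C + C *m z0 *m a) *m z.
    by rewrite mulmxDl mulmxDr !mulmxA.
  rewrite -ez; apply: Ab => i; rewrite mul_col_mx mxE.
  case: split => k; last by rewrite ez.
  by rewrite ez az0 mulNmx mul1mx subrr mul0mx mxE.
exists (row_mx (c *m (A *m z0) - b *m z0) c) => [i|].
  rewrite mxE; case: split => // k; rewrite !ord1 mxE [X in _ + X]mxE subr_ge0 (le_trans bz0)// mxE.
  by apply: sumr_ge0 => j _; rewrite mulr_ge0.
apply: (addIr (b *m z0 *m a)).
by rewrite bc mul_row_col mulmxBl addrAC subrK mulmxDr addrC !mulmxA.
Qed.
(** * Products of bounded elements of a quadratic module *)

Section BoundedElements.
Variables (R : realType) (A : comNzRingType) (c : {rmorphism R -> A}).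
Variable T : A -> Prop.

Definition quadratic_module :=
  [/\ forall a b, T a -> T b -> T (a + b),
      forall p a, T a -> T (p ^+ 2 * a)
    & forall k, 0 <= k -> T (c k)].

(** The infimum of these [k] is the order seminorm of [a] with respect to [T]. *)
Definition abs_le (k : R) (a : A) := T (c k - a) /\ T (c k + a).

(** The bound [N] on [p] makes the property stable under products. *)
Definition near_square (a : A) := forall e, 0 < e ->
  exists p N, [/\ 0 < N, abs_le N p & abs_le e (a - p ^+ 2)].

Hypothesis Tqm : quadratic_module.

Let TD a b : T a -> T b -> T (a + b). Proof. by case: Tqm => h _ _; apply: h. Qed.
Let TX p a : T a -> T (p ^+ 2 * a). Proof. by case: Tqm => _ h _; apply: h. Qed.
Let TC k : 0 <= k -> T (c k). Proof. by case: Tqm => _ _ h; apply: h. Qed.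

Lemma qm_scale k a : 0 <= k -> T a -> T (c k * a).
Proof. by move=> k0 Ta; rewrite -(sqr_sqrtr k0) rmorphXn; apply: TX. Qed.

Lemma qm_sqr a : T (a ^+ 2).
Proof. by rewrite -[_ ^+ 2]mulr1 -(rmorph1 c); apply/TX/TC. Qed.

Let c_half a : a = c 2^-1 * (a + a).
Proof.
rewrite -mulr2n -[a *+ 2]mulr_natl mulrA -(rmorph_nat c 2) -rmorphM.
by rewrite mulVf ?pnatr_eq0// rmorph1 mul1r.
Qed.

Let T_half a : T (a + a) -> T a.
Proof. by move=> Ta; rewrite [a]c_half; apply: qm_scale => //; rewrite invr_ge0. Qed.

Lemma abs_leN k a : abs_le k a -> abs_le k (- a).
Proof. by case=> h1 h2; split=> //; rewrite opprK. Qed.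

Lemma abs_leD k l a b : abs_le k a -> abs_le l b -> abs_le (k + l) (a + b).
Proof.
move=> [a1 a2] [b1 b2]; split.
  by have := TD a1 b1; congr T; ring.
by have := TD a2 b2; congr T; ring.
Qed.

Lemma abs_leW k l a : k <= l -> abs_le k a -> abs_le l a.
Proof.
move=> kl [a1 a2]; have kl0 : T (c (l - k)) by apply: TC; rewrite subr_ge0.
split; first by have := TD kl0 a1; congr T; ring.
by have := TD kl0 a2; congr T; ring.
Qed.

Lemma abs_leC k : 0 <= k -> abs_le k (c k).
Proof.
move=> k0; split; first by rewrite subrr -(rmorph0 c); apply: TC.
by rewrite -rmorphD; apply: TC; rewrite addr_ge0.
Qed.

Lemma abs_le_scale s k a : 0 <= s -> abs_le k a -> abs_le (s * k) (c s * a).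
Proof.
move=> s0 [a1 a2]; split.
  by have := qm_scale s0 a1; congr T; ring.
by have := qm_scale s0 a2; congr T; ring.
Qed.

(* 2 (1 - a^2) = (1 + a)^2 (1 - a) + (1 - a)^2 (1 + a). *)
Let unit_sqr a : abs_le 1 a -> T (1 - a ^+ 2).
Proof.
move=> [a1 a2]; apply: T_half; rewrite rmorph1 in a1 a2.
by have := TD (TX (1 + a) a1) (TX (1 - a) a2); congr T; ring.
Qed.

Let abs_leM1 a b : abs_le 1 a -> abs_le 1 b -> abs_le 1 (a * b).
Proof.
move=> /unit_sqr a1 /unit_sqr b1; split; apply: T_half; rewrite rmorph1.
  by have := TD (TD a1 b1) (qm_sqr (a - b)); congr T; ring.
by have := TD (TD a1 b1) (qm_sqr (a + b)); congr T; ring.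
Qed.

(** Submultiplicativity. After scaling both bounds to 1 it follows from
    2 (1 - ab) = (1 - a^2) + (1 - b^2) + (a - b)^2 and its analogue for -b. *)
Lemma abs_leM k l a b : 0 < k -> 0 < l ->
  abs_le k a -> abs_le l b -> abs_le (k * l) (a * b).
Proof.
move=> k0 l0.
have norm m x : 0 < m -> abs_le m x -> abs_le 1 (c m^-1 * x).
  by move=> m0 /(abs_le_scale (s := m^-1)); rewrite mulVf ?gt_eqF// invr_ge0; apply; apply: ltW.
move=> /(norm _ _ k0) ha /(norm _ _ l0) /(abs_leM1 ha).
move=> /(abs_le_scale (ltW (mulr_gt0 k0 l0))); rewrite mulr1; congr abs_le.
have e m x : 0 < m -> x = c m * (c m^-1 * x).
  by move=> m0; rewrite mulrA -rmorphM mulfV ?gt_eqF// rmorph1 mul1r.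
by rewrite rmorphM [in RHS](e k a)// [in RHS](e l b)//; ring.
Qed.

(** ab - (pq)^2 = (a - p^2) b + p^2 (b - q^2); the approximation of [b] is chosen
    after [p], since its accuracy depends on the size of [p]. *)
Lemma near_squareM a b : near_square a -> near_square b -> near_square (a * b).
Proof.
move=> Ha Hb e e0.
have [Nb Nb0 Hbb] : exists2 N, 0 < N & abs_le N b.
  have [q [N [N0 qN bq]]] := Hb 1 ltr01.
  exists (1 + N * N); first by rewrite addr_gt0 ?mulr_gt0.
  by have := abs_leD bq (abs_leM N0 N0 qN qN); congr abs_le; ring.
have [|p [N [N0 pN ap]]] := Ha (e / 2 / Nb); first by rewrite !divr_gt0.
have [|q [M [M0 qM bq]]] := Hb (e / 2 / (N * N)).
  by rewrite !divr_gt0 ?mulr_gt0.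
exists (p * q), (N * M); split; first by rewrite mulr_gt0.
  exact: abs_leM.
have h1 : abs_le (e / 2) ((a - p ^+ 2) * b).
  rewrite -[e / 2](@divfK _ Nb) ?gt_eqF//.
  by apply: abs_leM => //; rewrite !divr_gt0.
have h2 : abs_le (e / 2) (p * p * (b - q ^+ 2)).
  rewrite -[e / 2](@divfK _ (N * N)) ?mulf_neq0 ?gt_eqF// [_ * (N * N)]mulrC.
  apply: abs_leM; rewrite ?divr_gt0 ?mulr_gt0//; exact: abs_leM.
have := abs_leD h1 h2; rewrite -splitr; congr abs_le; ring.
Qed.

(** Up to an error of order [s ^+ 2], [y] is 1 - u with u of seminorm at most
    [k = 1 - s ^+ 2 < 1]. A root of 1 - u is 1 - q with q = (u + q^2) / 2; since
    [th = 1 - s] satisfies th = (k + th^2) / 2, the iterates of this fixed-point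
    equation from 0 stay in the ball of radius [th < 1], where the iteration
    contracts by the factor [th]. *)
Lemma near_square_unit y : T y -> T (1 - y) -> near_square y.
Proof.
move=> y0 y1 e e0.
pose s := Num.min (2^-1) (e / 2); pose th := 1 - s; pose k := 1 - s ^+ 2.
have s0 : 0 < s by rewrite lt_min invr_gt0 ltr0n divr_gt0.
have s1 : s <= 2^-1 by rewrite ge_min lexx.
have se : s <= e / 2 by rewrite ge_min lexx orbT.
have [th0 th1] : 0 < th /\ th < 1 by rewrite /th; split; lra.
have [k0 kth] : 0 < k /\ (k + th * th) / 2 = th by rewrite /k /th; split; nra.
pose u := c k * (1 - y).
have uk : abs_le k u.
  split; first by have := qm_scale (ltW k0) y0; congr T; rewrite /u; ring.
  have := TD (TC (ltW k0)) (qm_scale (ltW k0) y1); congr T; rewrite /u; ring.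
pose q := fix q j := if j is j'.+1 then c 2^-1 * (u + q j' * q j') else 0.
have half0 : 0 <= 2^-1 :> R by rewrite invr_ge0.
have qth j : abs_le th (q j).
  elim: j => [|j IH] /=; first by split; rewrite ?subr0 ?addr0; apply/TC/ltW.
  rewrite -kth mulrC; apply: abs_le_scale => //; apply: abs_leD => //.
  exact: abs_leM.
(* q_(j+2) - q_(j+1) is the previous difference times the mean of q_j and
   q_(j+1). *)
have dq j : abs_le (th ^+ j.+1) (q j.+1 - q j).
  elim: j => [|j IH].
    rewrite /= subr0 mulr0 addr0 expr1.
    apply: (@abs_leW (2^-1 * k)); last exact: abs_le_scale.
    by rewrite -kth mulrC ler_pM2r ?invr_gt0// lerDl mulr_ge0 ?ltW.
  have mean : abs_le th (c 2^-1 * (q j.+1 + q j)).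
    rewrite (_ : th = 2^-1 * (th + th)); last lra.
    by apply: abs_le_scale => //; apply: abs_leD.
  have := abs_leM (exprn_gt0 _ th0) th0 IH mean.
  by rewrite -exprSr; congr abs_le; rewrite /=; ring.
have [j hj] : exists j, th ^+ j.+1 <= e / 4.
  have e4 : 0 < e / 4 by rewrite divr_gt0.
  have /cvgr0_norm_lt/(_ _ e4) : GRing.exp th @ \oo --> 0.
    by apply: cvg_expr; rewrite ger0_norm// ltW.
  case=> j _ hj; exists j; have /ltW := hj j.+1 (leqnSn j).
  by rewrite ger0_norm ?exprn_ge0// ltW.
exists (1 - q j), 2; split => //.
  have := abs_leD (abs_leC ler01) (abs_leN (qth j)).
  rewrite rmorph1; apply: abs_leW; lra.
(* y - (1 - q_j)^2 = (y - (1 - u)) - 2 (q_(j+1) - q_j). *)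
have e1 : abs_le (e / 2) (c (s ^+ 2) * - (1 - y)).
  apply: (@abs_leW (s ^+ 2)); first by nra.
  rewrite -[X in abs_le X]mulr1; apply: abs_le_scale; first exact: sqr_ge0.
  split; rewrite rmorph1 ?opprK.
    by have := TD (qm_sqr 1) y1; congr T; ring.
  by have := y0; congr T; ring.
have e2 : abs_le (e / 2) ((1 + 1) * - (q j.+1 - q j)).
  apply: (@abs_leW ((1 + 1) * th ^+ j.+1)); first lra.
  apply: abs_leM; [lra|exact: exprn_gt0| |exact: abs_leN].
  rewrite -(rmorph1 c) -rmorphD; apply: abs_leC; lra.
have := abs_leD e1 e2; rewrite -splitr; congr abs_le.
have h2 : (1 + 1) * (c 2^-1 * (u + q j * q j)) = u + q j * q j.
  by rewrite [RHS]c_half; ring.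
rewrite /=; move: (c 2^-1 * _) h2 => w h2.
have -> : (1 + 1) * - (w - q j) = (1 + 1) * q j - (u + q j * q j).
  by rewrite -h2; ring.
rewrite /u /k; ring.
Qed.

End BoundedElements.
(** * Positive definite matrices *)

Lemma symmetricmxP (R : realType) l (P : 'M[R]_l) :
  reflect (P^T = P) (P \is symmetricmx).
Proof.
apply: (iffP (is_hermitianmxP _ _ _)); rewrite expr0 scale1r map_mx_id //.
Qed.

(** Cholesky: with pivot [a] and first row [w], the matrix P - w^T w / a is zero
    but for the Schur complement [S], and the value of [S] at [v] is the value of
    [P] at the extension of [v] that is annihilated by [w]. *)
Lemma pdmx_gram (R : realType) l (P : 'M[R]_l) : pdmx P ->
  exists vs : seq 'rV[R]_l, P = \sum_(v <- vs) v^T *m v.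
Proof.
elim: l P => [|l IHl]; first by exists [::]; rewrite big_nil; apply/matrixP => -[].
rewrite -[l.+1]/(1 + l)%N => P [/symmetricmxP symP posP].
pose a := P 0 0; pose b := ursubmx P; pose w : 'rV_(1 + l) := row_mx a%:M b.
have a0 : 0 < a.
  have := posP (delta_mx 0 0); rewrite trmx_delta -rowE -colE !mxE; apply.
  by apply/eqP => /matrixP/(_ 0 0)/eqP; rewrite !mxE !eqxx oner_eq0.
pose S := drsubmx P - a^-1 *: (b^T *m b).
have Pblock : P = a^-1 *: (w^T *m w) + block_mx 0 0 0 S.
  rewrite tr_row_mx mul_col_row scale_block_mx add_block_mx !addr0 tr_scalar_mx.
  rewrite -[LHS]submxK; congr block_mx.
  - by rewrite -scalar_mxM scale_scalar_mx mulKf ?gt_eqF// [LHS]mx11_scalar !mxE !lshift0.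
  - by rewrite mul_scalar_mx scalerA mulVf ?gt_eqF// scale1r.
  - rewrite mul_mx_scalar scalerA mulVf ?gt_eqF// scale1r /b.
    by rewrite trmx_ursub symP.
  - by rewrite /S addrC subrK.
have [|vs Svs] := IHl S.
  split.
    apply/symmetricmxP; rewrite /S linearB linearZ /= trmx_mul trmxK.
    by rewrite trmx_drsub symP.
  move=> v v0; pose u := col_mx (- a^-1 *: (b *m v)) v.
  have wu : w *m u = 0.
    rewrite mul_row_col mul_scalar_mx scalerA mulrN mulfV ?gt_eqF//.
    by rewrite scaleN1r addNr.
  have := posP u; rewrite Pblock mulmxDr mulmxDl -scalemxAr -scalemxAl.
  rewrite mulmxA -[_ *m w *m u]mulmxA wu mulmx0 scaler0 add0r.
  rewrite tr_col_mx mul_row_block !mulmx0 add0r mul_row_col mul0mx !add0r.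
  apply; apply: contra v0 => /eqP/(congr1 dsubmx); rewrite col_mxKd.
  by rewrite linear0 => ->.
exists (Num.sqrt a^-1 *: w :: [seq row_mx (0 : 'rV_1) v | v <- vs]).
rewrite big_cons big_map (_ : (_ *: w)^T = Num.sqrt a^-1 *: w^T); last by rewrite linearZ.
rewrite -scalemxAl -scalemxAr scalerA -expr2.
rewrite sqr_sqrtr ?invr_ge0 ?ltW// [LHS]Pblock; congr (_ + _).
rewrite Svs; elim: (vs) => [|v vs' IH]; rewrite ?big_nil ?block_mx0// !big_cons -IH.
by rewrite tr_row_mx mul_col_row !trmx0 !mul0mx !mulmx0 add_block_mx !addr0.
Qed.
(** * Penalizing the distance to a slice of the simplex *)

(** Where [f <= 0], a compact set, [g] is bounded below by a positive constant, so
    a large multiple of [g] makes the sum positive everywhere; the minimum of the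
    sum is the required [e]. *)
Lemma compact_penalty (T : topologicalType) (R : realType) (K : set T)
    (f g : T -> R) : compact K -> continuous f -> continuous g ->
    (forall x, K x -> 0 <= g x) -> (forall x, K x -> g x = 0 -> 0 < f x) ->
  exists C e, [/\ 0 <= C, 0 < e & forall x, K x -> e <= f x + C * g x].
Proof.
move=> cK cf cg g0 fg.
have minimum (K' : set T) (h : T -> R) : compact K' -> continuous h ->
    (forall x, K' x -> 0 < h x) ->
    exists2 e, 0 < e & forall x, K' x -> e <= h x.
  move=> cK' ch h0; have [[x0 Kx0]|/set0P/negP/negPn/eqP->] := pselect (K' !=set0); last first.
    by exists 1.
  have [|c /set_mem Kc hc] := compact_EVT_min _ cK' (continuous_subspaceT ch).
    by exists x0.
  by exists (h c) => [|x Kx]; [exact: h0|apply: hc; exact: mem_set].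
have [b b0 fb] : exists2 b, 0 <= b & forall x, K x -> - b <= f x.
  have [[x0 Kx0]|/set0P/negP/negPn/eqP->] := pselect (K !=set0); last by exists 0.
  have [|c /set_mem Kc hc] := compact_EVT_min _ cK (continuous_subspaceT cf).
    by exists x0.
  exists `|f c| => // x Kx; rewrite (le_trans _ (hc _ (mem_set Kx)))//.
  by rewrite lerNl ler_normr lexx orbT.
have cK0 : compact (K `&` f @^-1` [set y | y <= 0]).
  apply: compact_closedI => //; apply: preimage_closed; last exact: closed_le.
  by move=> x _; exact: cf.
have [x [Kx /= fx]|m m0 gm] := minimum _ g cK0 cg.
  rewrite lt_def g0// andbT; apply/eqP => gx.
  by have := fg _ Kx gx; rewrite ltNge fx.
pose C := (b + 1) / m.
have C0 : 0 <= C by apply: divr_ge0; [exact: addr_ge0|exact: ltW].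
have [||e e0 he] := minimum _ (fun x => f x + C * g x) cK.
- by move=> x; apply: cvgD; [exact: cf|apply: cvgM; [exact: cvg_cst|exact: cg]].
- move=> x Kx; have [fx|fx] := leP (f x) 0; last first.
    by rewrite ltr_wpDr// mulr_ge0// g0.
  have := fb _ Kx; have : b + 1 <= C * g x.
    by rewrite -[b + 1](@divfK _ m) ?gt_eqF// ler_wpM2l// gm.
  lra.
by exists C, e.
Qed.
Lemma continuous_mulmx (T : topologicalType) (R : realType) p q r
    (F : T -> 'M[R]_(p, q)) (G : T -> 'M[R]_(q, r)) :
    (forall i j, continuous (fun x => F x i j)) ->
    (forall i j, continuous (fun x => G x i j)) ->
  forall i j, continuous (fun x => (F x *m G x) i j).
Proof.
move=> cF cG i j; under eq_fun do rewrite mxE.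
apply: continuous_big; first exact: add_continuous.
by move=> k _ x; apply: cvgM; [exact: cF|exact: cG].
Qed.

Lemma normr_entry_le (R : realType) k (v : 'rV[R]_k) i : `|v 0 i| <= `|v|.
Proof.
by rewrite [leRHS]mx_normrE (le_bigmax _ (fun ij => `|v ij.1 ij.2|) (0, i)).
Qed.

Lemma normr_le_entries (R : realType) k (v : 'rV[R]_k) c :
  0 <= c -> (forall i, `|v 0 i| <= c) -> `|v| <= c.
Proof.
move=> c0 vc; rewrite [leLHS]mx_normrE; apply/bigmax_leP; split => // -[i j] _ /=.
by rewrite ord1.
Qed.

Definition normsq (R : realType) k (v : 'rV[R]_k) : R := (v *m v^T) 0 0.

Lemma normsqE (R : realType) k (v : 'rV[R]_k) : normsq v = \sum_i v 0 i ^+ 2.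
Proof. by rewrite /normsq mxE; apply: eq_bigr => i _; rewrite mxE expr2. Qed.

Lemma normsq_ge0 (R : realType) k (v : 'rV[R]_k) : 0 <= normsq v.
Proof. by rewrite normsqE sumr_ge0// => i _; rewrite sqr_ge0. Qed.

Lemma normsq_eq0 (R : realType) k (v : 'rV[R]_k) : normsq v = 0 -> v = 0.
Proof.
rewrite normsqE => /eqP; rewrite psumr_eq0; last by move=> i _; rewrite sqr_ge0.
move=> /allP v0; apply/rowP => i; rewrite mxE; apply/eqP; rewrite -sqrf_eq0.
by apply: (implyP (v0 i _)); rewrite ?mem_index_enum.
Qed.

Lemma normsqZ (R : realType) k c (v : 'rV[R]_k) : normsq (c *: v) = c ^+ 2 * normsq v.
Proof. by rewrite !normsqE mulr_sumr; apply: eq_bigr => i _; rewrite mxE exprMn. Qed.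

(** The matrix version of [compact_penalty]: positivity of the pencil on the
    slice [v *m h = 0] of the simplex is positivity of a function on the product
    of the simplex and a sphere. The scale [s] is a homogenization: the sampling
    argument below evaluates the pencil at integer points [v] with sum [s]. *)
Lemma pencil_penalty (R : realType) m k l (A : 'I_m -> 'M[R]_l) (h : 'M[R]_(m, k)) :
    (forall i, A i \is symmetricmx) ->
    (forall v : 'rV[R]_m, (forall i, 0 <= v 0 i) -> \sum_i v 0 i = 1 ->
       v *m h = 0 -> pdmx (\sum_i v 0 i *: A i)) ->
  exists C e : R, [/\ 0 <= C, 0 < e & forall (s : R) (v : 'rV[R]_m),
    0 < s -> (forall i, 0 <= v 0 i) -> \sum_i v 0 i = s ->
    pdmx (\sum_i v 0 i *: A i + (C / s * normsq (v *m h) - e * s)%:M)].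
Proof.
move=> sA pA; pose P (v : 'rV_m) := \sum_i v 0 i *: A i.
pose K : set 'rV[R]_(m + l) := [set x | [/\ forall i, 0 <= lsubmx x 0 i,
  \sum_i lsubmx x 0 i = 1 & normsq (rsubmx x) = 1]].
pose f (x : 'rV_(m + l)) : R := (rsubmx x *m P (lsubmx x) *m (rsubmx x)^T) 0 0.
pose g (x : 'rV_(m + l)) : R := normsq (lsubmx x *m h).
have cl i j : continuous (fun x : 'rV[R]_(m + l) => lsubmx x i j).
  by under eq_fun do rewrite mxE; exact: coord_continuous.
have cr i j : continuous (fun x : 'rV[R]_(m + l) => rsubmx x i j).
  by under eq_fun do rewrite mxE; exact: coord_continuous.
have crT i j : continuous (fun x : 'rV[R]_(m + l) => (rsubmx x)^T i j).
  by under eq_fun do rewrite mxE; exact: cr.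
have cst_mx p q (M : 'M[R]_(p, q)) i j : continuous (fun _ : 'rV[R]_(m + l) => M i j).
  exact: cst_continuous.
have cf : continuous f.
  apply: continuous_mulmx => //; apply: continuous_mulmx => //.
  move=> i j.
  under eq_fun do rewrite summxE.
  apply: continuous_big; first exact: add_continuous.
  move=> a _.
  have -> : (fun x => (lsubmx x 0 a *: A a) i j) = fun x : 'rV_(m + l) => lsubmx x 0 a * A a i j.
    by apply/funext => x; rewrite mxE.
  move=> x; apply: continuousM; [exact: cl|exact: cst_continuous].
have clh i j : continuous (fun x : 'rV[R]_(m + l) => (lsubmx x *m h) i j).
  exact: continuous_mulmx.
have cg : continuous g.
  apply: continuous_mulmx => // i j; under eq_fun do rewrite mxE; exact: clh.
have cK : compact K.
  apply: bounded_closed_compact.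
    exists 1; split; first exact: num_real.
    move=> b b1 x [x0 x1 x2]; apply: le_trans (ltW b1).
    apply: normr_le_entries => // i; rewrite -[x]hsubmxK mxE.
    case: split => j.
      rewrite ger0_norm// -x1 (bigD1 j)//= lerDl sumr_ge0//.
    have : `|rsubmx x 0 j : R| ^+ 2 <= 1.
      rewrite real_normK ?num_real// -x2 normsqE (bigD1 j)//= lerDl.
      by rewrite sumr_ge0// => *; rewrite sqr_ge0.
    by rewrite expr_le1.
  have -> : K = (\bigcap_(i in setT) [set x : 'rV[R]_(m + l) | 0 <= lsubmx x 0 i])
     `&` ((fun x : 'rV[R]_(m + l) => \sum_i lsubmx x 0 i) @^-1` [set x | x = 1]
     `&` (fun x => normsq (rsubmx x)) @^-1` [set x | x = 1]).
    apply/seteqP; split=> [x [x0 x1 x2]|x [x0 [x1 x2]]].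
      by split; [move=> i _; exact: x0|split].
    by split => // i; exact: (x0 i Logic.I).
  apply: closedI; [apply: closed_bigI => i _|apply: closedI].
  - apply: (@preimage_closed _ _ (fun x : 'rV[R]_(m + l) => lsubmx x 0 i)
      [set y | 0 <= y]); last exact: closed_ge.
    by move=> x _; exact: cl.
  - apply: preimage_closed; last exact: closed_eq.
    move=> x _; apply: continuous_big; first exact: add_continuous.
    by move=> i _; exact: cl.
  - apply: preimage_closed; last exact: closed_eq.
    move=> x _; exact: continuous_mulmx.
have quadE (x : 'rV[R]_l) (M : 'M[R]_l) c :
    (x *m (M + c%:M) *m x^T) 0 0 = (x *m M *m x^T) 0 0 + c * normsq x.
  by rewrite mulmxDr mulmxDl mul_mx_scalar -scalemxAl mxE [X in _ + X]mxE.
have [x _|x [x0 x1 x2] gx|C [e [C0 e0 Ce]]] := compact_penalty cK cf cg.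
- exact: normsq_ge0.
- have [_ /(_ (rsubmx x)^T)] := pA _ x0 x1 (normsq_eq0 gx).
  rewrite trmxK; apply; apply/eqP => x3; move: x2.
  by rewrite /normsq x3 mulmx0 mxE => /eqP; rewrite eq_sym oner_eq0.
exists C, (e / 2); split; rewrite ?divr_gt0// => s v s0 v0 vs.
split.
  apply/symmetricmxP; rewrite linearD /= tr_scalar_mx linear_sum /=.
  congr (_ + _); apply: eq_bigr => i _.
  by rewrite linearZ /= (symmetricmxP _ (sA i)).
move=> u u0; rewrite -[u in _ *m u]trmxK quadE.
have nu0 : 0 < normsq u^T.
  rewrite lt_def normsq_ge0 andbT; apply: contra u0 => /eqP/normsq_eq0/(congr1 trmx).
  by rewrite trmxK trmx0 => ->.
pose r := Num.sqrt (normsq u^T).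
have r0 : 0 < r by rewrite sqrtr_gt0.
(* By homogeneity, v and u are scaled to the simplex and to the sphere. *)
have := Ce (row_mx (s^-1 *: v) (r^-1 *: u^T)).
rewrite /K /f /g /= row_mxKl row_mxKr => H.
have {}H : e <= s^-1 * (r^-1 * (r^-1 * (u^T *m P v *m u) 0 0)) + C * (s^-1 ^+ 2 * normsq (v *m h)).
  apply: le_trans (H _) _; first split.
  - by move=> i; rewrite mxE mulr_ge0// invr_ge0 ltW.
  - under eq_bigr do rewrite mxE.
    by rewrite -mulr_sumr vs mulVf ?gt_eqF.
  - by rewrite normsqZ exprVn sqr_sqrtr ?mulVf ?gt_eqF// ltW.
  rewrite -(scalemxAl _ v) normsqZ lerD2r.
  have -> : P (s^-1 *: v) = s^-1 *: P v.
    by rewrite /P scaler_sumr; apply: eq_bigr => i _; rewrite mxE scalerA.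
  have -> : (r^-1 *: u^T)^T = r^-1 *: u by apply/colP => i; rewrite !mxE.
  have scaleE c (M : 'M[R]_1) : (c *: M) 0 0 = c * M 0 0 by rewrite mxE.
  rewrite -!scalemxAl -!scalemxAr -!scalemxAl !scaleE.
  rewrite le_eqVlt; apply/orP; left; apply/eqP; ring.
have rr : r * r = normsq u^T by rewrite -expr2 sqr_sqrtr// ltW.
rewrite -/(P v) trmxK -rr; move: H; set q := (_ *m _ *m _) 0 0; set w := normsq _ => H.
have := ler_wpM2l (ltW (mulr_gt0 s0 (mulr_gt0 r0 r0))) H.
have -> : s * (r * r) * (s^-1 * (r^-1 * (r^-1 * q)) + C * (s^-1 ^+ 2 * w))
   = q + (C / s * w) * (r * r) by field; rewrite !gt_eqF.
have : 0 < s * (r * r) * e by rewrite !mulr_gt0.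
rewrite mulrBl; lra.
Qed.
Lemma trmxZ (S : comNzRingType) p q (a : S) (M : 'M[S]_(p, q)) :
  (a *: M)^T = a *: M^T.
Proof. by apply/matrixP => i j; rewrite !mxE. Qed.

Lemma pdmx1 (R : realType) l : pdmx (1%:M : 'M[R]_l).
Proof.
split; first by apply/symmetricmxP; rewrite trmx1.
move=> v v0; rewrite mulmx1 -[v in _ *m v]trmxK -/(normsq v^T).
rewrite lt_def normsq_ge0 andbT; apply: contra v0 => /eqP/normsq_eq0/(congr1 trmx).
by rewrite trmxK trmx0 => ->.
Qed.

Lemma pdmx_perturb (R : realType) l (P : 'M[R]_l) e : 0 < e -> P \is symmetricmx ->
  exists2 eta, 0 < eta & pdmx (e%:M - eta *: P).
Proof.
move=> e0 sP; pose b := 1 + \sum_i \sum_j `|P i j|.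
have b0 : 0 < b by rewrite ltr_wpDr// sumr_ge0// => i _; rewrite sumr_ge0.
(* The coefficients of P sum in absolute value to b - 1, and 2 |u w| is at most
   u ^ 2 + w ^ 2, so the form of P is at most (b - 1) times the squared norm. *)
exists (e / b); first by rewrite divr_gt0.
split.
  apply/symmetricmxP; rewrite linearB /= tr_scalar_mx.
  by rewrite trmxZ (symmetricmxP _ sP).
move=> v v0; set q := (v^T *m v) 0 0.
have q0 : 0 < q by have [_ /(_ v v0)] := pdmx1 R l; rewrite mulmx1.
have qE : q = \sum_i v i 0 ^+ 2.
  by rewrite /q mxE; apply: eq_bigr => i _; rewrite mxE expr2.
have vq i : v i 0 ^+ 2 <= q.
  by rewrite qE (bigD1 i)//= lerDl sumr_ge0// => *; rewrite sqr_ge0.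
have bq : (v^T *m P *m v) 0 0 <= (b - 1) * q.
  rewrite /b addrC addKr exchange_big mulr_suml mxE; apply: ler_sum => j _.
  rewrite mxE !mulr_suml; apply: ler_sum => i _; rewrite mxE.
  rewrite (le_trans (ler_norm _))// mulrAC mulrC normrM ler_wpM2l//.
  rewrite ler_norml; have := vq i; have := vq j.
  have := sqr_ge0 (v i 0 + v j 0); have := sqr_ge0 (v i 0 - v j 0).
  by move=> *; apply/andP; split; nra.
rewrite mulmxBr mulmxBl mul_mx_scalar -scalemxAr -scalemxAl -scalemxAl.
have scaleE c (M : 'M[R]_1) : (c *: M) 0 0 = c * M 0 0 by rewrite mxE.
rewrite mxE [X in _ + X]mxE !scaleE -/q.
have -> : e * q = e / b * (b * q) by field; rewrite gt_eqF.
rewrite -mulrBr.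
by rewrite mulr_gt0 ?divr_gt0//; nra.
Qed.
(** * The matrix module of L1 and its scalar part *)

Section ModuleOfL1.
Variables (R : realType) (n d : nat) (L1 : mxpoly R n d d).

Definition in_module l (X : mxpoly R n l l) : Prop :=
  exists (As : seq (mxpoly R n l l)) (Bs : seq (mxpoly R n d l)),
    X = \sum_(A <- As) A^T *m A + \sum_(B <- Bs) B^T *m L1 *m B.

Lemma in_module0 l : in_module (0 : mxpoly R n l l).
Proof. by exists [::], [::]; rewrite !big_nil addr0. Qed.

Lemma in_moduleD l (X Y : mxpoly R n l l) :
  in_module X -> in_module Y -> in_module (X + Y).
Proof.
move=> [As [Bs ->]] [As' [Bs' ->]]; exists (As ++ As'), (Bs ++ Bs').
by rewrite !big_cat /= addrACA.
Qed.

Lemma in_module_sum l (I : Type) (r : seq I) (F : I -> mxpoly R n l l) :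
  (forall i, in_module (F i)) -> in_module (\sum_(i <- r) F i).
Proof.
by move=> HF; elim/big_ind: _ => //; [exact: in_module0|exact: in_moduleD].
Qed.

Lemma in_moduleZ l (q : mpoly n R) (X : mxpoly R n l l) :
  in_module X -> in_module (q ^+ 2 *: X).
Proof.
move=> [As [Bs ->]]; exists [seq q *: A | A <- As], [seq q *: B | B <- Bs].
rewrite scalerDr !big_map !scaler_sumr; congr (_ + _); apply: eq_bigr => M _.
  by rewrite trmxZ -scalemxAl -scalemxAr scalerA.
by rewrite trmxZ -!scalemxAl -scalemxAr scalerA.
Qed.

(** Quantifying over all rows [v], of any length, makes this a quadratic module:
    a factor p^2 is absorbed into [v]. *)
Definition scalar_module (p : mpoly n R) : Prop :=
  forall l (v : mxpoly R n 1 l), in_module (p *: (v^T *m v)).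

Lemma scalar_module1 : scalar_module 1.
Proof.
move=> [|l] v; first by rewrite [_ *: _]flatmx0; exact: in_module0.
exists [:: delta_mx 0 0 *m v], [::]; rewrite big_nil addr0 big_seq1 scale1r.
by rewrite trmx_mul mulmxA -[_ *m _ *m delta_mx 0 0]mulmxA trmx_delta mul_delta_mx
  (_ : delta_mx 0 0 = 1%:M) ?mulmx1//; apply/matrixP => i j; rewrite !ord1 !mxE.
Qed.

Lemma scalar_module_qm : quadratic_module (mpolyC n (R := R)) scalar_module.
Proof.
have X p a : scalar_module a -> scalar_module (p ^+ 2 * a).
  by move=> Ta l v; rewrite -scalerA; apply/in_moduleZ/Ta.
split=> // [a b Ta Tb l v|k k0]; first by rewrite scalerDl; apply: in_moduleD.
rewrite -(sqr_sqrtr k0) rmorphXn -[_ ^+ 2]mulr1; apply: X; exact: scalar_module1.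
Qed.

(** A matrix B whose only nonzero row is [v], at index [i], picks the entry
    [L1 i i] in B^T L1 B. *)
Lemma scalar_module_diag i : scalar_module (L1 i i).
Proof.
move=> l v; exists [::], [:: delta_mx i 0 *m v]; rewrite big_nil add0r big_seq1.
rewrite trmx_mul !mulmxA -[_ *m _ *m L1]mulmxA trmx_delta -[_ *m delta_mx i 0]mulmxA.
rewrite -rowE -colE [col _ _](_ : _ = (L1 i i)%:M); last first.
  by apply/matrixP => a b; rewrite !ord1 !mxE.
by rewrite mul_mx_scalar -scalemxAl.
Qed.

Lemma in_module_pd l p (P : 'M[R]_l) :
  scalar_module p -> pdmx P -> in_module (p *: mxpolyC P).
Proof.
move=> Tp /pdmx_gram[vs ->]; rewrite /mxpolyC raddf_sum scaler_sumr /=.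
by apply: in_module_sum => v; rewrite map_mxM -map_trmx; apply: Tp.
Qed.

Lemma in_module_scalar l p : scalar_module p -> in_module (p%:M : mxpoly R n l l).
Proof.
move=> Tp; rewrite -scalemx1 (_ : 1%:M = mxpolyC 1%:M); last by rewrite /mxpolyC map_mx1.
by apply: in_module_pd => //; exact: pdmx1.
Qed.

End ModuleOfL1.

(** * The cone generated by products *)

(** The sums of P times a product of the [y i], with P positive definite; this is
    the matrix analogue of the preordering generated by the [y i]. *)
Inductive poscone (R : realType) (n m l : nat) (y : 'I_m -> mpoly n R) :
    mxpoly R n l l -> Prop :=
| Poscone0 : poscone y 0
| PosconeC P : pdmx P -> poscone y (mxpolyC P)
| PosconeD X Y : poscone y X -> poscone y Y -> poscone y (X + Y)
| PosconeM i X : poscone y X -> poscone y (y i *: X).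

Lemma poscone_sum (R : realType) (n m l : nat) (y : 'I_m -> mpoly n R)
    (I : Type) (r : seq I) (F : I -> mxpoly R n l l) :
  (forall i, poscone y (F i)) -> poscone y (\sum_(i <- r) F i).
Proof. by move=> HF; elim/big_ind: _ => //; [exact: Poscone0|exact: PosconeD]. Qed.

(** Products of the [y i] need not belong to the scalar module (on a triangle the
    product of two sides does not), but they are close to squares, and the
    positive constant [e] absorbs the error. The factor [p] is what makes the
    induction work: it collects the product of the [y i] met so far. *)
Lemma poscone_in_module (R : realType) (n d : nat) (L1 : mxpoly R n d d)
    (m l : nat) (y : 'I_m -> mpoly n R) (X : mxpoly R n l l) :
    (forall i, near_square (mpolyC n (R := R)) (scalar_module L1) (y i)) ->
    poscone y X ->
  forall p e, near_square (mpolyC n (R := R)) (scalar_module L1) p -> 0 < e ->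
  in_module L1 (p *: X + (mpolyC n e)%:M).
Proof.
have qm := scalar_module_qm L1; move=> ny.
elim=> {X} [|P pP|X Y _ IHX _ IHY|i X _ IH] p e np e0.
- rewrite scaler0 add0r; apply: in_module_scalar; case: qm => _ _; apply; exact: ltW.
- (* p P + e = q^2 P + (eta + (p - q^2)) P + (e - eta P). *)
  have [eta eta0 pe] := pdmx_perturb e0 pP.1.
  have [q [N [_ _ [_ pq]]]] := np eta eta0.
  rewrite (_ : p *: _ + _ = q ^+ 2 *: mxpolyC P
    + ((mpolyC n eta + (p - q ^+ 2)) *: mxpolyC P + 1 *: mxpolyC (e%:M - eta *: P))).
    apply: in_moduleD; first by rewrite -[_ ^+ 2]mulr1; apply: in_module_pd => //;
      case: qm => _ + _; apply; exact: scalar_module1.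
    by apply: in_moduleD; apply: in_module_pd => //; exact: scalar_module1.
  have -> : mxpolyC (e%:M - eta *: P) = (mpolyC n e)%:M - mpolyC n eta *: mxpolyC P.
    by rewrite /mxpolyC raddfB /= map_scalar_mx map_mxZ.
  move: (mxpolyC P) => M; apply/matrixP => i j; rewrite !mxE. ring.
- rewrite scalerDr [e]splitr rmorphD raddfD /= addrACA.
  by apply: in_moduleD; [apply: IHX|apply: IHY] => //; rewrite divr_gt0.
- by rewrite scalerA; apply: IH => //; apply: near_squareM.
Qed.

(** * Bernstein expansion *)

(** Expanding powers of [\sum_i y i = 1] writes a function of the form [phi] as a
    combination of products of the [y i] with coefficients sampled at integer
    points. The operator v |-> \sum_i y i * phi (v + e_i) shifts the linear part of
    [phi] by [L]; because [y] is orthogonal to the columns of [h], it shifts the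
    quadratic part only by the variance [kappa], which does not depend on [v]. *)
Section Bernstein.
Variables (R : realType) (n m k l : nat).
Variables (y : 'I_m -> mpoly n R) (A : 'I_m -> 'M[R]_l) (h : 'M[R]_(m, k)).
Variables (c del : R).
Hypothesis y_sum : \sum_i y i = 1.
Hypothesis y_h : forall j, \sum_i y i * mpolyC n (h i j) = 0.

Let L : mxpoly R n l l := \sum_i y i *: mxpolyC (A i).
Let kappa : mpoly n R := \sum_i y i * mpolyC n (c * normsq (row i h)).
Let phi (v : 'rV[R]_m) : 'M[R]_l :=
  \sum_i v 0 i *: A i + (c * normsq (v *m h) - del)%:M.
(* The t-fold iterate of the shift operator on phi, evaluated at v. *)
Let E t v : mxpoly R n l l := mxpolyC (phi v) + t%:R *: (L + kappa%:M).

Let E_step t v : E t.+1 v = \sum_i y i *: E t (v + delta_mx 0 i).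
Proof.
have phiD i : phi (v + delta_mx 0 i) = phi v + A i +
    (c * normsq (row i h) + 2 * c * \sum_j (v *m h) 0 j * h i j)%:M.
   rewrite /phi; have -> : \sum_a (v + delta_mx 0 i) 0 a *: A a = \sum_a v 0 a *: A a + A i.
    under eq_bigr do rewrite !mxE scalerDl.
    rewrite big_split /=; congr (_ + _); rewrite (bigD1 i)//= eqxx scale1r.
    by rewrite big1 ?addr0// => j /negPf->; rewrite scale0r.
  have -> : normsq ((v + delta_mx 0 i) *m h) = normsq (v *m h) + normsq (row i h)
      + 2 * \sum_j (v *m h) 0 j * h i j.
    rewrite mulmxDl -rowE !normsqE mulr_sumr -!big_split; apply: eq_bigr => j _ /=.
    by rewrite mxE [row _ _ _ _]mxE; ring.
  move: (\sum_a _) (normsq _) (normsq _) (\sum_j _) => M a b s.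
  apply/matrixP => a' b'; rewrite !mxE; ring.
rewrite /E; under eq_bigr do rewrite phiD scalerDr.
rewrite big_split /= -scaler_suml y_sum scale1r -natr1 scalerDl scale1r.
rewrite addrCA [RHS]addrC; congr (_ + _).
have mC (M N : 'M[R]_l) s :
    mxpolyC (M + N + s%:M) = mxpolyC M + mxpolyC N + (mpolyC n s)%:M.
  by rewrite /mxpolyC !map_mxD map_scalar_mx.
under eq_bigr do rewrite mC scalerDr [_ *: (_ + _)]scalerDr.
rewrite !big_split /= -scaler_suml y_sum scale1r -addrA; congr (_ + (_ + _)).
under eq_bigr do rewrite scale_scalar_mx rmorphD mulrDr.
rewrite -raddf_sum /= big_split /= [X in _ + X](_ : _ = 0) ?addr0//.
under eq_bigr do rewrite rmorphM rmorph_sum /= mulr_sumr mulr_sumr.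
rewrite exchange_big /= big1 // => j _.
transitivity (mpolyC n (2 * c * (v *m h) 0 j) * \sum_i y i * mpolyC n (h i j)).
  by rewrite mulr_sumr; apply: eq_bigr => i _; rewrite !rmorphM /=; ring.
by rewrite y_h mulr0.
Qed.

Lemma bernstein_poscone N :
    (forall v : 'rV[R]_m, (forall i, 0 <= v 0 i) -> \sum_i v 0 i = N%:R -> pdmx (phi v)) ->
  poscone y ((mpolyC n (- del))%:M + N%:R *: (L + kappa%:M)).
Proof.
move=> phiN.
have gen t (v : 'rV[R]_m) : (forall i, 0 <= v 0 i) -> \sum_i v 0 i + t%:R = N%:R -> poscone y (E t v).
  elim: t v => [|t IH] v v0 vN.
    rewrite /E scale0r addr0; apply/PosconeC/phiN => //.
    by rewrite -vN addr0.
  rewrite E_step; apply: poscone_sum => i; apply/PosconeM/IH => [j|].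
    by rewrite !mxE addr_ge0.
  under eq_bigr do rewrite !mxE.
  rewrite big_split /= [X in _ + X + _](_ : _ = 1).
    by rewrite -vN -natr1; ring.
  rewrite (bigD1 i)//= eqxx big1 ?addr0 => // j /negPf->//.
have := gen N 0; rewrite /E /phi mul0mx (_ : normsq 0 = 0); last first.
  by rewrite /normsq mul0mx mxE.
have -> : \sum_i (0 : 'rV[R]_m) 0 i *: A i = 0.
  by apply: big1 => i _; rewrite [_ 0 i]mxE scale0r.
rewrite mulr0 !add0r.
rewrite /mxpolyC map_scalar_mx; apply => [i|]; first by rewrite mxE.
by rewrite big1 ?add0r// => i _; rewrite mxE.
Qed.

End Bernstein.
(** Here the penalty has weight [C / N] at points of size [N], so that the
    expansion of degree [N] gives N L + C \sum_i y i |h_i|^2 - e N. Its second term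
    does not grow with [N] and its last one does, so that for large [N] half of
    [e N] is left to compensate the second term and half to pass from the cone to
    the module. *)
Lemma simplex_slice_in_module (R : realType) (n d : nat) (L1 : mxpoly R n d d)
    (m k l : nat) (y : 'I_m -> mpoly n R) (A : 'I_m -> 'M[R]_l) (h : 'M[R]_(m, k)) :
    (forall i, scalar_module L1 (y i)) -> \sum_i y i = 1 ->
    (forall j, \sum_i y i * mpolyC n (h i j) = 0) ->
    (forall i, A i \is symmetricmx) ->
    (forall v : 'rV[R]_m, (forall i, 0 <= v 0 i) -> \sum_i v 0 i = 1 ->
       v *m h = 0 -> pdmx (\sum_i v 0 i *: A i)) ->
  in_module L1 (\sum_i y i *: mxpolyC (A i)).
Proof.
move=> Ty ysum yh sA pA; have qm := scalar_module_qm L1.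
have [TD TX TC] := qm.
have ny i : near_square (mpolyC n (R := R)) (scalar_module L1) (y i).
  apply: near_square_unit => //; rewrite -ysum (bigD1 i)//= addrAC subrr add0r.
  elim/big_ind: _ => //; first by rewrite -(mpolyC0 n R); apply: TC.
have n1 : near_square (mpolyC n (R := R)) (scalar_module L1) 1.
  apply: near_square_unit => //; first exact: scalar_module1.
  by rewrite subrr -(mpolyC0 n R); apply: TC.
have [C [e [C0 e0 Ce]]] := pencil_penalty sA pA.
pose H := \sum_i normsq (row i h).
have [N N0 HN] : exists2 N, (0 < N)%N & C * H / N%:R <= e / 2.
  exists (Num.bound (2 * (C * H) / e)).+1 => //.
  rewrite ler_pdivrMr ?ltr0n// [leRHS]mulrC -ler_pdivrMr ?divr_gt0//.
  rewrite (_ : _ / (e / 2) = 2 * (C * H) / e); last by field; rewrite gt_eqF.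
  rewrite ltW// (lt_le_trans (archi_boundP _)) ?ler_nat//.
  apply: divr_ge0; [|exact: ltW].
  by rewrite !mulr_ge0// sumr_ge0// => i _; exact: normsq_ge0.
have N0' : 0 < N%:R :> R by rewrite ltr0n.
have cone := bernstein_poscone ysum yh (fun v v0 vN => Ce _ v N0' v0 vN).
have eN : 0 < e * N%:R / 2 by rewrite divr_gt0// mulr_gt0.
have := in_moduleZ (mpolyC n (Num.sqrt N%:R^-1)) (poscone_in_module ny cone n1 eN).
set K := (X in _ + X%:M); set L := \sum_i _ => HK.
have Tres : scalar_module L1 (mpolyC n (e / 2) - K).
  have -> : mpolyC n (e / 2) - K =
      \sum_i mpolyC n (e / 2 - C / N%:R * normsq (row i h)) * y i.
    rewrite -[mpolyC n _ in LHS]mulr1 -ysum mulr_sumr /K -sumrB.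
    by apply: eq_bigr => i _; rewrite raddfB /=; ring.
  elim/big_ind: _ => //; first by rewrite -(mpolyC0 n R); apply: TC.
  move=> i _; apply: (qm_scale qm) => //; rewrite subr_ge0 (le_trans _ HN)//.
  rewrite mulrAC ler_wpM2r ?invr_ge0 ?ler0n// ler_wpM2l//.
  by rewrite /H (bigD1 i)//= lerDl sumr_ge0// => *; rewrite normsq_ge0.
have := in_moduleD HK (in_module_scalar l Tres).
rewrite scale1r -rmorphXn /= sqr_sqrtr ?invr_ge0// => HL.
rewrite [L](_ : _ = mpolyC n N%:R^-1 *:
  ((mpolyC n (- (e * N%:R)))%:M + N%:R *: (L + K%:M) +
       (mpolyC n (e * N%:R / 2))%:M) + (mpolyC n (e / 2) - K)%:M)//.
have natC : N%:R = mpolyC n (N%:R : R) :> mpoly n R by rewrite mpolyC_nat.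
have NN : mpolyC n (N%:R^-1 : R) * mpolyC n (N%:R : R) = 1.
  by rewrite -mpolyCM mulVf ?mpolyC1 ?gt_eqF.
have eNN : mpolyC n (e * N%:R / 2) = mpolyC n (e / 2) * mpolyC n (N%:R : R).
  by rewrite -mpolyCM; congr mpolyC; ring.
have eNN2 : mpolyC n (- (e * N%:R)) = - (mpolyC n (e / 2) * mpolyC n (N%:R : R) *+ 2).
  by rewrite -eNN -mpolyCMn -mpolyCN; congr mpolyC; rewrite mulr2n -splitr.
rewrite eNN eNN2 natC.
move: (mpolyC n _) (mpolyC n _) (mpolyC n _) (L) (K) NN => b N' a L' K' NN.
apply/matrixP => i j; rewrite !mxE.
transitivity (a * N' * (L' i j + (K' - b) *+ (i == j)) + (b - K') *+ (i == j)).
  by rewrite NN; ring.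
ring.
Qed.
(** * Simplex coordinates on a polytope *)

Lemma farkas_row (F : realFieldType) n m (A : 'M[F]_(n, m)) (b : 'cV[F]_n) :
    (forall z : 'rV[F]_n, (forall i, 0 <= (z *m A) 0 i) -> 0 <= (z *m b) 0 0) ->
  exists2 c : 'cV[F]_m, forall i, 0 <= c i 0 & b = A *m c.
Proof.
move=> Ab; have [z Az|c c0 bc] := @farkas _ _ _ A^T b^T.
  have -> : (b^T *m z) 0 0 = (z^T *m b) 0 0.
    by rewrite -[RHS]trace_mx11 -mxtrace_tr trmx_mul trmxK trace_mx11.
  apply: Ab => i; have := Az i; congr (_ <= _).
  by rewrite -[z in LHS]trmxK -trmx_mul mxE.
exists c^T => [i|]; first by rewrite mxE.
by rewrite -[b]trmxK bc trmx_mul trmxK.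
Qed.

Definition affine_row (S : comNzRingType) n (x : 'rV[S]_n) : 'rV[S]_(1 + n) :=
  row_mx 1%:M x.

(** The columns of [G] are the affine functions that define the polyhedron, with
    the constant term in row 0. *)
Definition polyhedron (R : realType) n d (G : 'M[R]_(1 + n, d)) : set 'rV[R]_n :=
  [set x | forall i, 0 <= (affine_row x *m G) 0 i].

Lemma row_scale_affine (R : realType) n (z : 'rV[R]_(1 + n)) (t := lsubmx z 0 0) :
  t != 0 -> z = t *: affine_row (t^-1 *: rsubmx z).
Proof.
move=> t0; rewrite scale_row_mx scalerA mulfV// scale1r scalemx1.
by rewrite -mx11_scalar hsubmxK.
Qed.

Lemma cone_in_polyhedron (R : realType) n d (G : 'M[R]_(1 + n, d)) (z : 'rV[R]_(1 + n))
    (t := lsubmx z 0 0) :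
  0 < t -> (forall i, 0 <= (z *m G) 0 i) -> polyhedron G (t^-1 *: rsubmx z).
Proof.
move=> t0 zG i; have := zG i; rewrite {1}(row_scale_affine (lt0r_neq0 t0)).
by rewrite -scalemxAl mxE pmulr_rge0.
Qed.

(** Such a [z] is a direction in which the polyhedron recedes: from [x0] it gives a
    ray in the polyhedron, which is bounded. *)
Lemma recession_eq0 (R : realType) n d (G : 'M[R]_(1 + n, d)) x0 (z : 'rV[R]_(1 + n)) :
    polyhedron G x0 -> bounded_set (polyhedron G) ->
    lsubmx z 0 0 = 0 -> (forall i, 0 <= (z *m G) 0 i) -> z = 0.
Proof.
move=> Dx0 [B [_ HB]] z0 zG; pose x := rsubmx z.
have zx : z = row_mx 0 x.
  by rewrite -[z]hsubmxK [lsubmx z]mx11_scalar z0 raddf0.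
have ray s : 0 <= s -> polyhedron G (x0 + s *: x).
  move=> s0 i; rewrite (_ : affine_row _ = affine_row x0 + s *: z); last first.
    by rewrite zx scale_row_mx scaler0 add_row_mx addr0.
  by rewrite mulmxDl -scalemxAl mxE [X in _ + X]mxE addr_ge0 ?mulr_ge0.
suff x00 : x = 0 by rewrite zx x00 row_mx0.
apply/eqP/negPn/negP => xn0.
have x1 : 0 < `|x| by rewrite normr_gt0.
pose K := `|B| + 1; pose s := (K + `|x0| + 1) / `|x|.
have s0 : 0 <= s by rewrite divr_ge0// ?addr_ge0.
have := HB K _ _ (ray s s0); rewrite ltr_pwDr ?ler_norm// => /(_ isT).
have : `|s *: x| <= `|x0 + s *: x| + `|x0|.
  by rewrite -[s *: x in leLHS](addKr x0) addrC (le_trans (ler_normB _ _)).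
rewrite normrZ (ger0_norm s0) divfK ?gt_eqF// => h1 h2.
by have := le_trans h1 (lerD h2 (lexx _)); rewrite gerDl ler10.
Qed.

Lemma mul_row_unit0 (S : comNzRingType) n (z : 'rV[S]_(1 + n)) :
  (z *m (delta_mx 0 0 : 'cV_(1 + n))) 0 0 = lsubmx z 0 0.
Proof. by rewrite -colE !mxE; congr (z _ _); apply/val_inj. Qed.

Lemma mul_row_unit (S : comNzRingType) n d (z : 'rV[S]_(1 + n)) (G : 'M[S]_(1 + n, d)) :
  z *m row_mx (delta_mx 0 0 : 'cV_(1 + n)) G = row_mx (lsubmx z) (z *m G).
Proof.
rewrite mul_mx_row; congr row_mx.
by apply/matrixP => i j; rewrite !ord1 mul_row_unit0.
Qed.

(** The columns of [H] are the constant 1 and the functions of [G]. Their sum is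
    bounded on the polytope, by [K] say, so that 1 - (1 / K) \sum_i G_i is
    nonnegative there; Farkas' lemma writes it as a nonnegative combination of
    columns of [H], and moving the sum to the other side leaves positive weights
    on the columns of [G]. A vector killed by the weighted functions is then
    killed by [H], hence a recession direction: this gives the rank. *)
Lemma polytope_weights (R : realType) n d (G : 'M[R]_(1 + n, d)) x0
    (H := row_mx (delta_mx 0 0 : 'cV_(1 + n)) G) :
    polyhedron G x0 -> bounded_set (polyhedron G) ->
  exists w : 'rV[R]_(1 + d), [/\ forall i, 0 <= w 0 i,
    forall i, 0 < w 0 (rshift 1 i), H *m diag_mx w *m const_mx 1 = delta_mx 0 0 :> 'cV_(1 + n)
    & row_free (H *m diag_mx w)].
Proof.
move=> Dx0 bD.
have HE (z : 'rV_(1 + n)) : z *m H = row_mx (lsubmx z) (z *m G) by exact: mul_row_unit.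
have [K K0 DK] : exists2 K, 0 < K & forall x, polyhedron G x ->
    \sum_i (affine_row x *m G) 0 i <= K.
  have [B [_ HB]] := bD; pose B' := `|B| + 1.
  pose K := 1 + \sum_(i < d) \sum_a ((1 + B') * `|G a i|).
  have B0 : 0 <= B' by rewrite addr_ge0.
  exists K; first by rewrite ltr_wpDr// sumr_ge0// => i _; rewrite sumr_ge0// => a _; rewrite mulr_ge0// addr_ge0.
  move=> x Dx; rewrite ler_wpDl//; apply: ler_sum => i _; rewrite mxE.
  apply: ler_sum => a _; rewrite (le_trans (ler_norm _))// normrM ler_wpM2r//.
  rewrite mxE; case: split => j; first by rewrite !mxE !ord1 normr1 lerDl.
  have xB : `|x| <= B' by apply: HB Dx; rewrite ltr_pwDr ?ler_norm.
  by rewrite (le_trans (normr_entry_le _ _))// (le_trans xB)// lerDr.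
(* Farkas' lemma is homogeneous: the points of the cone at height 0 are
   recession directions, and the others are multiples of points of the
   polytope. *)
have [z zH|c c0 bc] := @farkas_row _ _ _ H
    (delta_mx 0 0 - K^-1 *: (G *m const_mx 1)).
  have zG i : 0 <= (z *m G) 0 i by have := zH (rshift 1 i); rewrite HE row_mxEr.
  have t0 : 0 <= lsubmx z 0 0 by have := zH (lshift d 0); rewrite HE row_mxEl.
  have [t1|t1] := eqVneq (lsubmx z 0 0) 0.
    by rewrite (recession_eq0 Dx0 bD t1 zG) mul0mx mxE.
  have {t0}t0 : 0 < lsubmx z 0 0 by rewrite lt_def t1.
  have := DK _ (cone_in_polyhedron t0 zG); set t := lsubmx z 0 0 in t0 *.
  move=> sumK; rewrite mulmxBr -scalemxAr mulmxA mxE mul_row_unit0 -/t.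
  have -> : (- (K^-1 *: (z *m G *m const_mx 1)) : 'M[R]_1) 0 0 = - (K^-1 * \sum_i (z *m G) 0 i).
    rewrite mxE; congr (- _); rewrite mxE; congr (_ * _); rewrite mxE.
    by apply: eq_bigr => i _; rewrite [const_mx _ _ _]mxE mulr1.
  rewrite subr_ge0 mulrC ler_pdivrMr// {1}(row_scale_affine (lt0r_neq0 t0)) -/t.
  rewrite -scalemxAl; under eq_bigr do rewrite mxE.
  by rewrite -mulr_sumr ler_pM2l.
pose w := c^T + K^-1 *: row_mx (0 : 'rV_1) (const_mx 1).
have w1 : H *m diag_mx w *m const_mx 1 = delta_mx 0 0 :> 'cV_(1 + n).
  rewrite -mulmxA [diag_mx w *m _](_ : _ = w^T); last first.
    by apply/colP => i; rewrite mul_diag_mx !mxE mulr1.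
  rewrite /w linearD /= trmxK mulmxDr -bc trmxZ -scalemxAr /H tr_row_mx mul_row_col.
  by rewrite trmx0 mulmx0 add0r trmx_const subrK.
have wi i : 0 < w 0 (rshift 1 i).
  rewrite mxE [X in X + _]mxE [X in _ + X]mxE row_mxEr [const_mx _ _ _]mxE mulr1.
  by rewrite ltr_wpDl ?invr_gt0.
exists w; split => //.
  move=> i; rewrite mxE addr_ge0 ?[c^T _ _]mxE// mxE mulr_ge0 ?invr_ge0 ?(ltW K0)//.
  by rewrite mxE; case: split => j; rewrite mxE.
apply/inj_row_free => z; rewrite mulmxA => zY.
have zH i : (z *m H) 0 i * w 0 i = 0.
  by have := congr1 (fun M : 'rV_(1 + d) => M 0 i) zY; rewrite mul_mx_diag mxE => ->; rewrite mxE.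
have z0 : lsubmx z 0 0 = 0.
  have := congr1 (mulmx z) w1; rewrite !mulmxA zY mul0mx => /matrixP/(_ 0 0).
  by rewrite mul_row_unit0 mxE => <-.
apply: (recession_eq0 Dx0 bD z0) => i.
have /eqP := zH (rshift 1 i); rewrite mulf_eq0 [w _ _ == 0]gt_eqF// orbF.
by rewrite HE row_mxEr => /eqP->.
Qed.
(** * Positive linear matrix polynomials on a polytope *)

Lemma linear_mxpolyE (R : realType) n d (L : mxpoly R n d d) : linear_mxpoly L ->
  exists Q : 'I_(1 + n) -> 'M[R]_d,
    L = \sum_a affine_row (\row_i mxpolyX i) 0 a *: mxpolyC (Q a).
Proof.
move=> [P0 [P ->]].
pose Q (a : 'I_(1 + n)) := match split a with inl _ => P0 | inr i => P i end.
pose F a := affine_row (\row_i mxpolyX i) 0 a *: mxpolyC (Q a) : mxpoly R n d d.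
exists Q.
transitivity (\sum_(a < 1) F (lshift n a) + \sum_(i < n) F (rshift 1 i)).
  rewrite big_ord1 /F /Q row_mxEl mxE scale1r; congr (_ + _).
    by have := unsplitK (inl 0 : 'I_1 + 'I_n); rewrite /= => ->.
  apply: eq_bigr => i _; rewrite row_mxEr mxE.
  by have := unsplitK (inr i : 'I_1 + 'I_n); rewrite /= => ->.
by rewrite [RHS]big_split_ord.
Qed.

Lemma mxeval_linear (R : realType) n d (Q : 'I_(1 + n) -> 'M[R]_d) x :
  mxeval x (\sum_a affine_row (\row_i mxpolyX i) 0 a *: mxpolyC (Q a)) =
  \sum_a affine_row x 0 a *: Q a.
Proof.
rewrite /mxeval raddf_sum /=; apply: eq_bigr => a _; rewrite map_mxZ /=.
have -> : map_mx (meval (fun i => x 0 i)) (mxpolyC (Q a)) = Q a.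
  by apply/matrixP => i j; rewrite !mxE mevalC.
congr (_ *: _); rewrite !mxE; case: split => i; rewrite !mxE ?mevalXU//.
by rewrite mulrb; case: eqP; rewrite ?meval1 ?meval0.
Qed.

Lemma sum_scale_mulmx (S : comNzRingType) p q l (u : 'rV[S]_p) (B : 'M[S]_(p, q))
    (Q : 'I_q -> 'M[S]_l) :
  \sum_i u 0 i *: (\sum_a B i a *: Q a) = \sum_a (u *m B) 0 a *: Q a.
Proof.
under eq_bigr do rewrite scaler_sumr; rewrite exchange_big /=.
apply: eq_bigr => a _; rewrite mxE scaler_suml; apply: eq_bigr => i _.
by rewrite scalerA.
Qed.

Lemma gram_rows (S : comNzRingType) p q (Z : 'M[S]_(p, q)) :
  Z^T *m Z = \sum_i (row i Z)^T *m row i Z.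
Proof.
apply/matrixP => a b; rewrite mxE summxE; apply: eq_bigr => i _.
by rewrite [RHS]mxE big_ord1 !mxE.
Qed.

(** X = ((X + 1) / 2)^2 - ((X - 1) / 2)^2, and -1 is in the scalar module. *)
Lemma in_module_symmetric (R : realType) n d l (L1 : mxpoly R n d d) (X : mxpoly R n l l) :
  scalar_module L1 (- 1) -> X^T = X -> in_module L1 X.
Proof.
move=> T1 sX; pose half := mpolyC n (2^-1 : R).
have sq (Z : mxpoly R n l l) p : scalar_module L1 p -> in_module L1 (p *: (Z^T *m Z)).
  by move=> Tp; rewrite gram_rows scaler_sumr; apply: in_module_sum => i; apply: Tp.
pose U := half *: (X + 1%:M); pose V := half *: (X - 1%:M).
have -> : X = 1 *: (U^T *m U) + (- 1) *: (V^T *m V).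
  have h4 : half * half * 4 = 1.
    rewrite (_ : 4 = mpolyC n (4 : R)); last by rewrite mpolyC_nat.
    by rewrite -!mpolyCM (_ : _ * 4 = 1) ?mpolyC1//; field.
  rewrite /U /V !trmxZ linearD linearB /= sX trmx1 -!scalemxAl -!scalemxAr !scalerA.
  rewrite !(mulmxDl, mulmxDr, mulmxBl, mulmxBr, mulmxN, mulNmx) !mul1mx !mulmx1.
  move: (X *m X) (1%:M) (half) h4 => XX I b h4; apply/matrixP => i j; rewrite !mxE.
  transitivity (b * b * 4 * X i j); first by rewrite h4 mul1r.
  ring.
by apply: in_moduleD; apply: sq => //; exact: scalar_module1.
Qed.

Lemma symmetric_mxpolyE (R : realType) n d (L : mxpoly R n d d) :
  symmetric_mxpoly L -> L^T = L.
Proof.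
move=> sL; apply/matrixP => i j; apply/mpolyP => m.
have /symmetricmxP/matrixP/(_ i j) := sL m; rewrite !mxE.
by [].
Qed.

Lemma diagonal_mxpolyE (R : realType) n d (L : mxpoly R n d d) i j :
  diagonal_mxpoly L -> i != j -> L i j = 0.
Proof.
move=> dL ij; apply/mpolyP => m; rewrite mcoeff0.
by have /is_diag_mxP/(_ i j ij) := dL m; rewrite mxE.
Qed.

Lemma psd_set_diagonal (R : realType) n d (L : mxpoly R n d d) x :
  diagonal_mxpoly L -> psd_set L x <-> forall i, 0 <= mxeval x L i i.
Proof.
move=> dL; have off i j : i != j -> mxeval x L i j = 0.
  by move=> ij; rewrite mxE (diagonal_mxpolyE dL ij) meval0.
split=> [[_ psd] i|psd].
  by have := psd (delta_mx i 0); rewrite trmx_delta -rowE -colE !mxE.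
split.
  apply/symmetricmxP/matrixP => i j; rewrite [LHS]mxE.
  by have [->//|ij] := eqVneq i j; rewrite !off// eq_sym.
move=> v; rewrite mxE sumr_ge0// => j _; rewrite mxE (bigD1 j)//= big1 => [|i ij].
  by rewrite addr0 mxE mulrAC -expr2 mulr_ge0// sqr_ge0.
by rewrite off// mulr0.
Qed.

Theorem theorem3 (R : realType) (n d : nat) (L1 : mxpoly R n d d)
    (L1_sym : symmetric_mxpoly L1) (L1_lin : linear_mxpoly L1)
    (L1_diag : diagonal_mxpoly L1) (L1_bounded : bounded_set (psd_set L1)) :
  forall (l : nat) (L2 : mxpoly R n l l),
    symmetric_mxpoly L2 -> linear_mxpoly L2 ->
    (forall x : 'rV[R]_n, psd_set L1 x -> pdmx (mxeval x L2)) ->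
    exists (As : seq (mxpoly R n l l)) (Bs : seq (mxpoly R n d l)),
      L2 = \sum_(A <- As) A^T *m A + \sum_(B <- Bs) B^T *m L1 *m B.
Proof.
move=> l L2 /symmetric_mxpolyE L2_sym /linear_mxpolyE[P0 L2E] L2_pos.
rewrite -/(in_module L1 L2).
have [Q L1E] := linear_mxpolyE L1_lin.
pose G := \matrix_(a, i) Q a i i.
pose X : 'rV[mpoly n R]_(1 + n) := affine_row (\row_i mxpolyX i).
have L1G i : L1 i i = (X *m mxpolyC G) 0 i.
  rewrite L1E summxE mxE; apply: eq_bigr => a _; rewrite [mxpolyC G _ _]mxE.
  by rewrite [G _ _]mxE [LHS]mxE [mxpolyC _ _ _]mxE.
have setE x : psd_set L1 x <-> polyhedron G x.
  have e i : mxeval x L1 i i = (affine_row x *m G) 0 i.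
    by rewrite L1E mxeval_linear summxE mxE; apply: eq_bigr => a _; rewrite !mxE.
  by split=> [/(psd_set_diagonal _ L1_diag) h i|h]; [rewrite -e|
    apply/(psd_set_diagonal _ L1_diag) => i; rewrite e].
have {}setE : psd_set L1 = polyhedron G by apply/funext => x; apply/propext.
rewrite setE in L1_bounded L2_pos.
have TC k : 0 <= k -> scalar_module L1 (mpolyC n k).
  by have [_ _] := scalar_module_qm L1; apply.
pose H := row_mx (delta_mx 0 0 : 'cV_(1 + n)) G.
have X1 : lsubmx X = 1%:M by rewrite /X /affine_row row_mxKl.
have XH : X *m mxpolyC H = row_mx 1%:M (X *m mxpolyC G).
  by rewrite /H /mxpolyC map_row_mx map_delta_mx mul_row_unit X1.
have Xdelta : (X *m (delta_mx 0 0 : 'cV_(1 + n))) 0 0 = 1.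
  by rewrite mul_row_unit0 X1 mxE.
have TH i : scalar_module L1 ((X *m mxpolyC H) 0 i).
  rewrite XH mxE; case: split => j.
    by rewrite ord1 mxE; exact: scalar_module1.
  by rewrite -L1G; exact: scalar_module_diag.
have [[x0 Dx0]|D0] := pselect (polyhedron G !=set0); last first.
  (* The cone over the empty polyhedron contains no point of positive height, so
     Farkas' lemma applies to minus the height. *)
  apply: in_module_symmetric => //.
  have [z zH|c c0 bc] := @farkas_row _ _ _ H (- delta_mx 0 0).
    rewrite mul_row_unit in zH.
    have zG i : 0 <= (z *m G) 0 i by have := zH (rshift 1 i); rewrite row_mxEr.
    have t0 : 0 <= lsubmx z 0 0 by have := zH (lshift d 0); rewrite row_mxEl.
    have [t1|t1] := eqVneq (lsubmx z 0 0) 0.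
      by rewrite mulmxN mxE mul_row_unit0 t1 oppr0.
    case: D0; eexists; apply: cone_in_polyhedron zG.
    by rewrite lt_def t1.
  have -> : - 1 = \sum_i mpolyC n (c i 0) * (X *m mxpolyC H) 0 i.
    have := congr1 (fun M => (X *m mxpolyC M) 0 0) bc.
    rewrite /mxpolyC map_mxM map_mxN map_delta_mx mulmxN mulmxA mxE Xdelta => ->.
    by rewrite mxE; apply: eq_bigr => i _; rewrite [map_mx _ c _ _]mxE mulrC.
  elim/big_ind: _ => [||i _]; first by rewrite -(mpolyC0 n R); apply: TC.
    by have [TD _ _] := scalar_module_qm L1; exact: TD.
  by apply: (qm_scale (scalar_module_qm L1)).
have [w [w0 wpos w1 wfree]] := polytope_weights Dx0 L1_bounded.
rewrite -/H in w1 wfree; set Y := H *m diag_mx w in w1 wfree.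
have /row_freeP[B YB] := wfree.
(* The coefficients that linearity provides need not be known to be symmetric:
   averaging L2 with its transpose replaces them by symmetric ones. *)
pose P a := 2^-1 *: (P0 a + (P0 a)^T).
have Psym a : P a \is symmetricmx.
  by apply/symmetricmxP; rewrite /P trmxZ linearD /= trmxK addrC.
have {}L2E : L2 = \sum_a X 0 a *: mxpolyC (P a).
  transitivity (mpolyC n (2^-1 : R) *: (L2 + L2^T)).
    rewrite L2_sym scalerDr -scalerDl -mpolyCD (_ : _ + _ = 1) ?mpolyC1 ?scale1r//.
    by field.
  rewrite {}L2E linear_sum -big_split scaler_sumr; apply: eq_bigr => a _ /=.
  apply/matrixP => i j; rewrite !mxE mpolyCM mpolyCD; ring.
have XE (S : comNzRingType) (f : {rmorphism R -> S}) (u : 'rV[S]_(1 + n))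
    (F : 'I_(1 + n) -> 'M[S]_l) :
    \sum_i (u *m map_mx f Y) 0 i *: (\sum_a f (B i a) *: F a) = \sum_a u 0 a *: F a.
  have := sum_scale_mulmx (u *m map_mx f Y) (map_mx f B) F.
  rewrite -mulmxA -map_mxM YB map_mx1 mulmx1 => <-.
  apply: eq_bigr => i _; congr (_ *: _).
  by apply: eq_bigr => a _; rewrite mxE.
(* B recovers (1, x) from y (x), so that L2 is a linear pencil in y. *)
pose A i := \sum_a B i a *: P a.
have -> : L2 = \sum_i (X *m mxpolyC Y) 0 i *: mxpolyC (A i).
  rewrite L2E -(XE _ (mpolyC n (R := R))); apply: eq_bigr => i _; congr (_ *: _).
  rewrite /mxpolyC raddf_sum /=; apply: eq_bigr => a _.
  by move: (P a) => M; apply/matrixP => j k; rewrite !mxE mpolyCM.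
(* The cokernel of Y cuts the image of y out of the simplex. *)
apply: (@simplex_slice_in_module _ _ _ _ _ _ _ _ _ (cokermx Y)).
- move=> i; rewrite /Y /mxpolyC map_mxM mulmxA map_diag_mx mul_mx_diag mxE mulrC [X in X * _]mxE.
  apply: (qm_scale (scalar_module_qm L1)); [exact: w0|exact: TH].
- have := congr1 (fun M => (X *m mxpolyC M) 0 0) w1.
  rewrite /mxpolyC map_mxM map_delta_mx mulmxA Xdelta => <-.
  rewrite [RHS]mxE; apply: eq_bigr => i _.
  by rewrite [map_mx _ (const_mx 1) _ _]mxE [const_mx _ _ _]mxE rmorph1 mulr1.
- move=> j; have := congr1 (fun M => (X *m mxpolyC M) 0 j) (mulmx_coker Y).
  rewrite /mxpolyC map_mxM mulmxA map_mx0 mulmx0 [RHS]mxE => X0; rewrite -[RHS]X0.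
  by rewrite [RHS]mxE; apply: eq_bigr => i _; rewrite [map_mx _ (cokermx Y) _ _]mxE.
- move=> i; apply/symmetricmxP; rewrite /A linear_sum; apply: eq_bigr => a _ /=.
  by rewrite trmxZ (symmetricmxP _ (Psym a)).
- move=> v v0 v1 /eqP; rewrite -submxE => /submxP[z vz].
  have t1 : lsubmx z 0 0 = 1.
    rewrite -v1 vz; transitivity ((z *m Y *m const_mx 1 : 'M_1) 0 0).
      by rewrite -mulmxA w1 mul_row_unit0.
    by rewrite mxE; apply: eq_bigr => i _; rewrite [const_mx _ _ _]mxE mulr1.
  have zE : z = affine_row (rsubmx z).
    rewrite -[z in LHS]hsubmxK /affine_row; congr row_mx.
    by rewrite [LHS]mx11_scalar t1.
  have Dz : polyhedron G (rsubmx z).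
    move=> i; rewrite -zE; have := v0 (rshift 1 i).
    rewrite vz /Y mulmxA mul_mx_diag mxE mul_row_unit row_mxEr.
    by rewrite pmulr_lge0.
  have := L2_pos _ Dz; rewrite L2E mxeval_linear -zE.
  by rewrite vz sum_scale_mulmx -mulmxA YB mulmx1.
Qed.
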